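(* Let $G$ be a finite simple graph with $n$ vertices. If $\alpha(G)>n/2$, then $|core(G)|>|N(core(G))|$.
   Context: $\alpha(G)$ is the maximum size of a stable set of $G$; $\Omega(G)$ is the set of maximum stable sets; $core(G)=\bigcap\{S:S\in\Omega(G)\}$; for $A\subseteq V(G)$, $N(A)$ is the set of all vertices adjacent to at least one vertex of $A$. *)

(* Defs.v *)
(* A finite simple graph is a symmetric irreflexive relation e on a
   finType of vertices. *)
From mathcomp Require Import all_boot.

Set Implicit Arguments.
Unset Strict Implicit.
Unset Printing Implicit Defensive.

Section Graph.
Variables (V : finType) (e : rel V).

Definition stable (S : {set V}) : bool :=
  [forall u in S, forall v in S, ~~ e u v].

Definition alpha : nat := \max_(S : {set V} | stable S) #|S|.

Definition Omega : {set {set V}} :=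
  [set S : {set V} | stable S && (#|S| == alpha)].

Definition core : {set V} := \bigcap_(S in Omega) S.

(* Open neighborhood of a set: it may meet A when A is not stable. *)
Definition nbhd (A : {set V}) : {set V} :=
  [set v | [exists u in A, e u v]].

End Graph.

(* Main.v *)
(* For S0, S1, ..., Sk in Omega with intersection I and union U, no vertex of I
   is adjacent to a vertex of U.  Adding a further S in Omega does not decrease
   |I| + |U|: the set (S :&: U) :|: I is stable, so its size is at most |S|, and
   hence |I :\: S| <= |S :\: U|.  Thus 2 alpha <= |core| + |corona|, where the
   corona is the union of Omega.  As N(core) misses the corona,
   2 alpha <= |core| + n - |N(core)|. *)
Require Import Defs.
From mathcomp Require Import all_boot zify.

Section CoreCorona.
Variables (V : finType) (e : rel V).
Hypothesis e_sym : symmetric e.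

Lemma stableP (S : {set V}) :
  reflect {in S &, forall u v, ~~ e u v} (stable e S).
Proof.
apply: (iffP forall_inP) => [St u v uS vS | St u uS].
  by have /forall_inP := St u uS; apply.
by apply/forall_inP => v; apply: St.
Qed.

Lemma leq_alpha (S : {set V}) : stable e S -> #|S| <= alpha e.
Proof. exact: (@leq_bigmax_cond _ (stable e) (fun T : {set V} => #|T|)). Qed.

Lemma OmegaP (S : {set V}) :
  reflect (stable e S /\ #|S| = alpha e) (S \in Omega e).
Proof. by rewrite inE; apply: (iffP andP) => -[St /eqP]. Qed.

Lemma Omega_nonempty : exists S, S \in Omega e.
Proof.
have St0 : stable e set0 by apply/stableP => u v; rewrite inE.
have [|S StS eqS] := @eq_bigmax_cond _ (stable e) (fun S : {set V} => #|S|).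
  by apply/card_gt0P; exists set0.
by exists S; apply/OmegaP.
Qed.

(** This is [|I :\: S| <= |S :\: U|] in additive form, free of truncated subtraction. *)
Lemma card_exchange (I U S : {set V}) :
    stable e I -> {in I & U, forall u v, ~~ e u v} -> S \in Omega e ->
  #|I| + #|U| <= #|S :&: I| + #|S :|: U|.
Proof.
move=> /stableP StI nIU /OmegaP[/stableP StS cS].
have /leq_alpha : stable e ((S :&: U) :|: I).
  apply/stableP => u v /setUP[/setIP[uS uU]|uI] /setUP[/setIP[vS vU]|vI].
  - exact: StS.
  - by rewrite e_sym nIU.
  - exact: nIU.
  - exact: StI.
(* Inclusion-exclusion on the stable set subtracts the left-hand side; the goal has the right-hand
   side. *)
have : #|S :&: U :&: I| <= #|S :&: I|.
  by apply: subset_leq_card; rewrite setSI ?subsetIl.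
have := cardsUI (S :&: U) I; have := cardsUI S U; lia.
Qed.

(** The final [S0] keeps the family nonempty; alone, it gives equality. *)
Lemma double_alpha_leq_seq (S0 : {set V}) (s : seq {set V}) :
    S0 \in Omega e -> {subset s <= Omega e} ->
  2 * alpha e <=
    #|\bigcap_(S <- rcons s S0) S| + #|\bigcup_(S <- rcons s S0) S|.
Proof.
move=> S0O; elim: s => [|S s IHs] sO.
  by rewrite !big_seq1; have /OmegaP[_ ->] := S0O; rewrite mul2n addnn.
have sO' : {subset rcons s S0 <= Omega e}.
  move=> T; rewrite mem_rcons inE => /predU1P[-> // | Ts].
  by apply: sO; rewrite inE Ts orbT.
have capS T : T \in rcons s S0 -> \bigcap_(S <- rcons s S0) S \subset T.
  by rewrite bigcap_seq; apply: bigcap_inf.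
rewrite rcons_cons !big_cons.
apply: leq_trans (card_exchange _ _ _ _ _ _); last by apply: sO; rewrite mem_head.
- by apply: IHs => T Ts; apply: sO; rewrite inE Ts orbT.
- have S0s : S0 \in rcons s S0 by rewrite mem_rcons mem_head.
  have /OmegaP[/stableP St0 _] := S0O.
  by apply/stableP => u v uI vI; apply: St0; apply: (subsetP (capS _ S0s)).
(* A member [T] containing [v] also contains [u], which lies in every member, so stability of [T]
   applies. *)
- move=> u v uI; rewrite bigcup_seq => /bigcupP[T Ts vT].
  have /OmegaP[/stableP StT _] := sO' T Ts.
  by apply: StT => //; apply: (subsetP (capS T Ts)).
Qed.

Lemma double_alpha_leq :
  2 * alpha e <= #|core e| + #|\bigcup_(S in Omega e) S|.
Proof.
have [S0 S0O] := Omega_nonempty.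
have sO : {subset enum (Omega e) <= Omega e} by move=> S; rewrite mem_enum.
(* Repeating [S0] is harmless: intersection and union depend only on membership. *)
have eqO : rcons (enum (Omega e)) S0 =i Omega e.
  by move=> S; rewrite mem_rcons inE mem_enum; case: eqP => // ->.
have := double_alpha_leq_seq S0 _ S0O sO.
by rewrite bigcap_seq bigcup_seq (eq_bigl _ _ eqO) (eq_bigl _ _ eqO).
Qed.

(** Each maximum stable set contains the core, so none contains a neighbor of a core vertex. *)
Lemma nbhd_core_corona :
  nbhd e (core e) \subset ~: \bigcup_(S in Omega e) S.
Proof.
apply/subsetP => v; rewrite !inE => /exists_inP[u uC euv].
apply/negP => /bigcupP[S SO vS].
have uS : u \in S by move/bigcapP: uC; apply.
by have /OmegaP[/stableP/(_ u v uS vS)/negP] := SO.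
Qed.

End CoreCorona.

Theorem theorem5 (V : finType) (e : rel V)
    (e_sym : symmetric e) (e_irr : irreflexive e) :
  #|V| < 2 * alpha e -> #|nbhd e (core e)| < #|core e|.
Proof.
have := double_alpha_leq _ _ e_sym; have := subset_leq_card (nbhd_core_corona _ e).
have := cardsC (\bigcup_(S in Omega e) S); lia.
Qed.
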